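(* Suppose that $m,r$ are integers with $0\le r\le m$, and let $f_m(r)=2^{-r}\sum_{i=0}^r\binom{m}{i}$. If $m\notin\{0,3,6,9,12\}$, then the maximum value of $f_m(r)$ over $0\le r\le m$ occurs when $r=\lfloor\frac{m}{3}\rfloor+1$; that is, $f_m(r)\le f_m\left(\lfloor\frac{m}{3}\rfloor+1\right)$ for all integers $r$ with $0\le r\le m$.
   Context: $m$ is a non-negative integer and $\binom{m}{i}$ is the usual binomial coefficient. *)

(* Defs.v *)
From mathcomp Require Import all_boot all_order all_algebra.
Set Implicit Arguments.
Unset Strict Implicit.
Unset Printing Implicit Defensive.
Import Order.TTheory GRing.Theory Num.Theory.
Local Open Scope ring_scope.

Definition f (m r : nat) : rat :=
  2%:R ^- r * \sum_(0 <= i < r.+1) 'C(m, i)%:R.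

(* Main.v *)
(* Write s(r) for the r-th partial binomial sum.  Then f_m(r) <= f_m(r+1) iff
   s(r) <= C(m,r+1), i.e. iff D(r) >= r+1 where
   D(r) = (r+1) C(m,r+1) / s(r) = (m-r) C(m,r) / s(r).
   Since D(r+1) = (m-r-1) D(r) / (r+1+D(r)) is increasing in D(r), bounds on D
   propagate by induction on r.  The bounds used are the first convergents of
     D(r) = a + 2r / (a+3 + 4(r-1) / (a+6 + ...)),   a = m-2r,
   which lie alternately below and above D(r).  The lower bound a already gives
   D(r) >= r+1 for 3r < m, the third convergent settles 3r = m (for r >= 5), and
   the second one gives D(r) <= r+1 for 2r <= m < 3r.  For 2r > m one simply has
   C(m,r+1) <= C(m,r) <= s(r). *)
Require Import Defs.
From mathcomp Require Import all_boot all_order all_algebra.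
From mathcomp Require Import zify ring lra.
Set Implicit Arguments.
Unset Strict Implicit.
Unset Printing Implicit Defensive.
Import Order.TTheory GRing.Theory Num.Theory.
Local Open Scope ring_scope.

Definition binsum (m r : nat) : rat := \sum_(0 <= i < r.+1) 'C(m, i)%:R.

Lemma binsum0 m : binsum m 0 = 1.
Proof. by rewrite /binsum big_nat1 bin0. Qed.

Lemma binsumS m r : binsum m r.+1 = binsum m r + 'C(m, r.+1)%:R.
Proof. by rewrite /binsum big_nat_recr. Qed.

Lemma bin_le_binsum m r : 'C(m, r)%:R <= binsum m r.
Proof. by rewrite /binsum big_nat_recr //= lerDr sumr_ge0. Qed.

Lemma mul_bin_succ m r : (r <= m)%N ->
  (r%:R + 1) * 'C(m, r.+1)%:R = (m%:R - r%:R) * 'C(m, r)%:R :> rat.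
Proof. by move=> rm; rewrite natr1 -natrB // -!natrM mul_bin_left. Qed.

Lemma f_leS m r : (f m r <= f m r.+1) = (binsum m r <= 'C(m, r.+1)%:R).
Proof.
rewrite /f -!/(binsum _ _) binsumS exprS invfM -mulrA mulrCA.
rewrite ler_pM2l ?invr_gt0 ?exprn_gt0 //.
by apply/idP/idP => ?; lra.
Qed.

Lemma f_geS m r : (f m r.+1 <= f m r) = ('C(m, r.+1)%:R <= binsum m r).
Proof.
rewrite /f -!/(binsum _ _) binsumS exprS invfM -mulrA mulrCA.
rewrite ler_pM2l ?invr_gt0 ?exprn_gt0 //.
by apply/idP/idP => ?; lra.
Qed.

Section ConvergentStep.
Variables (s c x d N Q N' Q' : rat).
Hypotheses (c_ge0 : 0 <= c) (N_gt0 : 0 < N) (N'_ge0 : 0 <= N').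

(* Here s is the old sum and c the added coefficient, x = r+1 and d = m-r-1;
   the bound N/Q on D(r) is turned into the bound N'/Q' on D(r+1). *)
Lemma convergent_step_ge :
    s * N <= x * c * Q -> N' * (x * Q + N) <= d * Q' * N ->
  (s + c) * N' <= d * c * Q'.
Proof.
move=> h1 h2; rewrite -(ler_pM2r N_gt0).
have := ler_wpM2r N'_ge0 h1; have := ler_wpM2l c_ge0 h2.
by lra.
Qed.

Lemma convergent_step_le :
    x * c * Q <= s * N -> d * Q' * N <= N' * (x * Q + N) ->
  d * c * Q' <= (s + c) * N'.
Proof.
move=> h1 h2; rewrite -(ler_pM2r N_gt0).
have := ler_wpM2r N'_ge0 h1; have := ler_wpM2l c_ge0 h2.
by lra.
Qed.
End ConvergentStep.

(** At r = 0 this bound and the next two are equalities. In the induction step the two sides of the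
    polynomial premise of the convergent step differ by exactly 2(r+1), 8r(r+1) and 48(r-1)r(r+1)
    respectively; these products are nonnegative, so each bound passes from r to r+1. *)
Lemma binsum_convergent1 m r (a := m%:R - 2 * r%:R : rat) : (r.*2 <= m)%N ->
  binsum m r * a <= (m%:R - r%:R) * 'C(m, r)%:R.
Proof.
rewrite {}/a; elim: r => [|r IH] rm; first by rewrite binsum0 bin0; lra.
have {}IH := IH ltac:(lia).
(* The hypothesis now speaks of C(m,r+1), the coefficient [c] that the goal both adds to the sum and
   has on its right. *)
rewrite -mul_bin_succ in IH; last by lia.
have ram : 2 * (r%:R + 1) <= m%:R :> rat by rewrite natr1 -natrM ler_nat; lia.
have r0 : 0 <= r%:R :> rat by [].
(* The denominators [Q] and [Q'] are 1 here and are made explicit as factors. *)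
rewrite binsumS -[r.+1%:R]natr1 -[X in _ <= X]mulr1 -[X in _ <= X]mulrA mulrA.
rewrite -[X in _ <= X]mulr1 in IH.
move: (r%:R) (m%:R) r0 ram IH => x y r0 ram IH.
apply: (convergent_step_ge _ _ _ IH); rewrite ?ler0n //; first by lra.
  by lra.
by rewrite -subr_ge0 (_ : _ - _ = 2 * (x + 1)); [lra | ring].
Qed.

Lemma binsum_convergent2 m r (a := m%:R - 2 * r%:R : rat) : (r.*2 <= m)%N ->
  (m%:R - r%:R) * 'C(m, r)%:R * (a + 3) <=
  binsum m r * (a * (a + 3) + 2 * r%:R).
Proof.
rewrite {}/a; elim: r => [|r IH] rm; first by rewrite binsum0 bin0; lra.
have {}IH := IH ltac:(lia).
rewrite -mul_bin_succ in IH; last by lia.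
have ram : 2 * (r%:R + 1) <= m%:R :> rat by rewrite natr1 -natrM ler_nat; lia.
have r0 : 0 <= r%:R :> rat by [].
rewrite binsumS -[r.+1%:R]natr1.
move: (r%:R) (m%:R) r0 ram IH => x y r0 ram IH.
apply: (convergent_step_le _ _ _ IH); rewrite ?ler0n //; [by nra | by nra |].
rewrite -subr_ge0 (_ : _ - _ = 8 * x * (x + 1)); last by ring.
by nra.
Qed.

Lemma binsum_convergent3 m r (a := m%:R - 2 * r%:R : rat)
    (q := (a + 3) * (a + 6) + 4 * (r%:R - 1)) : (r.*2 <= m)%N ->
  binsum m r * (a * q + 2 * r%:R * (a + 6)) <= (m%:R - r%:R) * 'C(m, r)%:R * q.
Proof.
rewrite {}/q {}/a; elim: r => [|r IH] rm; first by rewrite binsum0 bin0; lra.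
have {}IH := IH ltac:(lia).
rewrite -mul_bin_succ in IH; last by lia.
have ram : 2 * (r%:R + 1) <= m%:R :> rat by rewrite natr1 -natrM ler_nat; lia.
have r0 : 0 <= r%:R :> rat by [].
(* This needs r to be an integer, as it fails between 0 and 1; hence it is recorded before r is
   generalized to a rational. *)
have rr0 : 0 <= r%:R * (r%:R - 1) :> rat.
  by case: (r) => [|k]; rewrite ?mul0r // -natr1 addrK mulr_ge0 // natr1.
rewrite binsumS -[r.+1%:R]natr1.
move: (r%:R) (m%:R) r0 rr0 ram IH => x y r0 rr0 ram IH.
apply: (convergent_step_ge _ _ _ IH); rewrite ?ler0n //.
- have: 2 <= y - 2 * x by lra.
  move: (y - 2 * x) => a a2.
  have a_sq : 0 <= a * a by rewrite mulr_ge0 //; lra.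
  have q0 : 0 < (a + 3) * (a + 6) + 4 * (x - 1) by lra.
  by rewrite ltr_pwDl //; [rewrite mulr_gt0 //; lra | nra].
- have: 0 <= y - 2 * (x + 1) by lra.
  move: (y - 2 * (x + 1)) => a a0.
  have q0 : 0 <= (a + 3) * (a + 6) + 4 * (x + 1 - 1).
    by rewrite addrK addr_ge0 // mulr_ge0 //; lra.
  by rewrite addr_ge0 // mulr_ge0 //; lra.
rewrite -subr_ge0 (_ : _ - _ = 48 * (x * (x - 1)) * (x + 1)); last by ring.
by rewrite mulr_ge0 ?(mulr_ge0 _ rr0) //; lra.
Qed.

Lemma f_leS_below m r : (3 * r < m)%N -> f m r <= f m r.+1.
Proof.
move=> rm; rewrite f_leS.
have h := @binsum_convergent1 m r ltac:(lia).
rewrite -mul_bin_succ in h; last by lia.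
have ram : r%:R + 1 <= m%:R - 2 * r%:R :> rat.
  by rewrite lerBrDr natr1 -natrM -natrD ler_nat; lia.
have r0 : 0 < r%:R + 1 :> rat by rewrite natr1 ltr0n.
have s0 : 0 <= binsum m r by exact: le_trans (bin_le_binsum m r).
rewrite -(ler_pM2l r0); apply: le_trans h; rewrite mulrC.
exact: ler_wpM2l.
Qed.

(** Here a = k, and the third convergent is at least k+1 iff k^2 - k - 14 >= 0, that is, iff k >= 5.
    The values k <= 4 give the excluded m = 0, 3, 6, 9, 12. *)
Lemma f_leS_third k : (5 <= k)%N -> f (3 * k) k <= f (3 * k) k.+1.
Proof.
move=> k5; rewrite f_leS.
have h := @binsum_convergent3 (3 * k) k ltac:(lia).
rewrite -mul_bin_succ in h; last by lia.
have kR : 5 <= k%:R :> rat by rewrite ler_nat.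
have s0 : 0 <= binsum (3 * k) k by exact: le_trans (bin_le_binsum _ _).
rewrite natrM in h.
move: (k%:R) (binsum _ _) ('C(_, _)%:R) kR s0 h => x s c kR s0.
rewrite (_ : 3%:R * x - 2 * x = x); last by ring.
set q := (x + 3) * (x + 6) + 4 * (x - 1) => h.
have q0 : 0 < (x + 1) * q by rewrite /q mulr_gt0 //; nra.
have nq : (x + 1) * q <= x * q + 2 * x * (x + 6) by rewrite /q; nra.
rewrite -(ler_pM2r q0) (mulrC c); apply: (le_trans (ler_wpM2l s0 nq)).
by rewrite [leRHS]mulrAC.
Qed.

Lemma f_geS_above m r : (r <= m < 3 * r)%N -> f m r.+1 <= f m r.
Proof.
move=> /andP[rm mr]; rewrite f_geS.
have r0 : 0 < r%:R + 1 :> rat by rewrite natr1 ltr0n.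
have rmR : m%:R + 1 <= 3 * r%:R :> rat by rewrite natr1 -natrM ler_nat.
have [ram|ram] := leqP r.*2 m; last first.
  apply: le_trans (bin_le_binsum m r).
  rewrite -(ler_pM2l r0) mul_bin_succ // ler_wpM2r //.
  by rewrite lerBlDr natr1 -natrD ler_nat; lia.
have h := @binsum_convergent2 m r ram.
rewrite -mul_bin_succ // in h.
have ramR : 2 * r%:R <= m%:R :> rat by rewrite -natrM ler_nat; lia.
have s0 : 0 <= binsum m r by exact: le_trans (bin_le_binsum _ _).
move: (r%:R) (m%:R) (binsum _ _) ('C(_, _)%:R) r0 rmR ramR s0 h
  => x y s c r0 rmR ramR s0.
set a := y - 2 * x => h.
have a0 : 0 <= a by rewrite /a; lra.
have ax : a + 1 <= x by rewrite /a; lra.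
have q0 : 0 < (x + 1) * (a + 3) by rewrite mulr_gt0 //; lra.
(* With x = a + 1 + t and t >= 0, the right side exceeds the left by 4 + t(a + 1). *)
have nq : a * (a + 3) + 2 * x <= (x + 1) * (a + 3) by nra.
rewrite -(ler_pM2r q0); apply: le_trans (ler_wpM2l s0 nq).
by rewrite mulrA (mulrC c).
Qed.

Theorem theorem1 (m : nat) (hm : m \notin [:: 0; 3; 6; 9; 12]%N) :
  (m %/ 3 + 1 <= m)%N /\
  (forall r : nat, (r <= m)%N -> f m r <= f m (m %/ 3 + 1)%N).
Proof.
rewrite addn1; split=> [|r rm].
  by move: hm; rewrite !inE; lia.
have up i : (i <= m %/ 3)%N -> f m i <= f m i.+1.
  move=> im; have [im3|mi3] := ltnP (3 * i) m; first exact: f_leS_below.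
  have mE : m = (3 * i)%N by lia.
  by rewrite mE; apply: f_leS_third; move: hm; rewrite mE !inE; lia.
have [rk|kr] := leqP r (m %/ 3).+1.
  (* Comparisons of neighbours give monotonicity on a convex set of indices: f ascends up to
     floor(m/3) + 1 and, below, descends from there to m. *)
  have convex_le : {in [pred i | i <= (m %/ 3).+1]%N &, forall i j k,
      (i < k < j)%N -> (k <= (m %/ 3).+1)%N}.
    by move=> i j; rewrite !inE; lia.
  apply: (Order.NatMonotonyTheory.nondecn_inP convex_le) (rk); rewrite ?inE //.
  by move=> i _; rewrite inE ltnS => /up.
have convex_ge : {in [pred i | m %/ 3 < i <= m]%N &, forall i j k,
    (i < k < j)%N -> (m %/ 3 < k <= m)%N}.
  by move=> i j; rewrite !inE; lia.
apply: (Order.NatMonotonyTheory.nonincn_inP convex_ge) (ltnW kr);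
  rewrite ?inE; try lia.
by move=> i; rewrite !inE => im _; apply: f_geS_above; lia.
Qed.
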